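(* Let $G$ be a graph with $\operatorname{diam}(G)=2$ and order $n(G)$. Then $$\gamma_g(G)\le \left\lceil \frac{n(G)}{2}\right\rceil .$$ Moreover, equality holds if and only if $G$ is isomorphic to one of the following eight graphs: (1) the cycle $C_4$; (2) the cycle $C_5$; (3) the complete bipartite graph $K_{3,3}$; (4) the triangular prism (two disjoint triangles $a_0a_1a_2$ and $b_0b_1b_2$ together with the edges $a_0b_0,a_1b_1,a_2b_2$); (5) the graph on $\{u_0,\dots,u_5\}$ with edges $u_0u_1,u_1u_2,u_2u_3,u_3u_4,u_4u_0,u_4u_5,u_5u_2$; (6) the graph on $\{u_0,\dots,u_5\}$ with edges $u_0u_1,u_1u_2,u_2u_3,u_3u_4,u_4u_0,u_4u_5,u_5u_2,u_1u_5$; (7) the graph on $\{u_0,\dots,u_5\}$ with edges $u_0u_1,u_1u_2,u_2u_3,u_3u_4,u_4u_0,u_4u_5,u_5u_2,u_5u_3$; (8) the Petersen graph.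
   Context: Graphs are finite, simple and undirected; $n(G)$ is the number of vertices. A vertex dominates itself and its neighbors. The domination game on a graph $G$ is played by Dominator and Staller, who alternately select vertices of $G$; each selected vertex must dominate at least one vertex not dominated by the previously selected vertices. The game ends when the selected vertices form a dominating set of $G$. Dominator aims to finish the game in as few moves as possible, Staller aims for the opposite. In the D-game Dominator makes the first move. The game domination number $\gamma_g(G)$ is the total number of vertices selected in the D-game when both players play optimally. *)

(* Defs.v *)
From mathcomp Require Import all_boot.

Set Implicit Arguments.
Unset Strict Implicit.
Unset Printing Implicit Defensive.

(* A graph is a symmetric irreflexive relation [e] on a finite type [T].      *)

(* [is_dist e x y d] has no solution [d] when [x] and [y] are not connected. *)
Definition is_dist (T : finType) (e : rel T) (x y : T) (d : nat) : Prop :=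
  (exists p : seq T, [/\ path e x p, last x p = y & size p = d]) /\
  (forall p : seq T, path e x p -> last x p = y -> d <= size p).

(* In particular the graph is connected and nonempty.                        *)
Definition has_diam (T : finType) (e : rel T) (d : nat) : Prop :=
  (forall x y : T, exists2 k, is_dist e x y k & k <= d) /\
  (exists x y : T, is_dist e x y d).

Definition graph_iso (T U : finType) (e : rel T) (f : rel U) : Prop :=
  exists2 h : T -> U, bijective h & forall x y : T, f (h x) (h y) = e x y.

Definition cl_nbhd (T : finType) (e : rel T) (v : T) : {set T} :=
  [set u | (u == v) || e v u].

Definition dominated (T : finType) (e : rel T) (S : {set T}) : {set T} :=
  \bigcup_(v in S) cl_nbhd e v.

Definition dominating (T : finType) (e : rel T) (S : {set T}) : bool :=
  dominated e S == [set: T].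

Definition legal (T : finType) (e : rel T) (S : {set T}) (v : T) : bool :=
  ~~ (cl_nbhd e v \subset dominated e S).

(* Minimax number of moves still to be played once [S] has been selected;    *)
(* [dom] tells whether Dominator is to move.  The argument [k] only bounds   *)
(* the recursion depth, and the default value of the minimum is never        *)
(* smaller than the values minimized: see [moves_leftE_dom] and              *)
(* [moves_leftE_stal] for the resulting bound-free recursion.                *)
Fixpoint game_value (T : finType) (e : rel T) (k : nat) (dom : bool)
    (S : {set T}) : nat :=
  if k is k'.+1 then
    if dominating e S then 0
    else (if dom then \big[minn/k']_(v | legal e S v)
                        game_value e k' false (v |: S)
          else \max_(v | legal e S v) game_value e k' true (v |: S)).+1
  else 0.

Definition moves_left (T : finType) (e : rel T) (dom : bool) (S : {set T}) :=
  game_value e (#|T| - #|S|) dom S.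

Definition game_dom_number (T : finType) (e : rel T) : nat :=
  moves_left e true set0.

Lemma game_value_le (T : finType) (e : rel T) k dom S :
  game_value e k dom S <= k.
Proof.
elim: k dom S => [|k IHk] [] S //=; case: ifP => // _; rewrite ltnS.
  by elim/big_rec: _ => // v m _ mk; apply: leq_trans (geq_minr _ _) mk.
by apply/bigmax_leqP.
Qed.

Lemma legal_notin (T : finType) (e : rel T) (S : {set T}) (v : T) :
  legal e S v -> v \notin S.
Proof. by apply: contra => vS; apply: (bigcup_sup v vS). Qed.

Lemma legal_exists (T : finType) (e : rel T) (S : {set T}) :
  ~~ dominating e S -> exists v, legal e S v.
Proof.
rewrite /dominating eqEsubset subsetT /= => /subsetPn[v _ vS].
by exists v; apply/subsetPn; exists v => //; rewrite inE eqxx.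
Qed.

Lemma legal_card (T : finType) (e : rel T) (S : {set T}) (v : T) :
  legal e S v -> #|T| - #|S| = (#|T| - #|v |: S|).+1.
Proof.
move=> /legal_notin vS; have:= max_card (v |: S).
by rewrite cardsU1 vS add1n => ?; rewrite -subSn.
Qed.

Lemma moves_left_dominating (T : finType) (e : rel T) dom (S : {set T}) :
  dominating e S -> moves_left e dom S = 0.
Proof. by rewrite /moves_left; case: (_ - _) => //= k ->. Qed.

Lemma moves_leftE_dom (T : finType) (e : rel T) (S : {set T}) :
  ~~ dominating e S ->
  (exists2 v, legal e S v
     & moves_left e true S = (moves_left e false (v |: S)).+1) /\
  (forall v, legal e S v ->
     moves_left e true S <= (moves_left e false (v |: S)).+1).
Proof.
move=> nS; have [v0 lv0] := legal_exists nS.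
pose k := #|T| - #|v0 |: S|.
have kE v : legal e S v ->
    moves_left e false (v |: S) = game_value e k false (v |: S).
  by move=> lv; congr game_value; apply: succn_inj;
    rewrite -!(legal_card (e := e)).
have -> : moves_left e true S
    = (\big[minn/k]_(v | legal e S v) game_value e k false (v |: S)).+1.
  by rewrite /moves_left (legal_card lv0) /= (negPf nS).
have min_le v : legal e S v ->
    \big[minn/k]_(v | legal e S v) game_value e k false (v |: S)
      <= game_value e k false (v |: S).
  move=> lv; have := mem_index_enum v; elim: (index_enum T) => //= w r IHr.
  rewrite inE big_cons => /predU1P[<-|/IHr le_r]; first by rewrite lv geq_minl.
  by case: ifP => // _; apply: leq_trans (geq_minr _ _) le_r.
split; last by move=> v lv; rewrite kE // ltnS min_le.
suff [v lv vE] : exists2 v, legal e S v &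
    \big[minn/k]_(v | legal e S v) game_value e k false (v |: S)
      = game_value e k false (v |: S).
  by exists v; rewrite ?kE ?vE.
have [mk|//] : \big[minn/k]_(v | legal e S v) game_value e k false (v |: S) = k
    \/ exists2 v, legal e S v &
      \big[minn/k]_(v | legal e S v) game_value e k false (v |: S)
        = game_value e k false (v |: S).
  elim/big_rec: _ => [|v n lv IH]; first by left.
  by rewrite /minn; case: ifP => // _; right; exists v.
exists v0 => //; apply/eqP; rewrite eqn_leq min_le //= mk.
exact: game_value_le.
Qed.

Lemma moves_leftE_stal (T : finType) (e : rel T) (S : {set T}) :
  ~~ dominating e S ->
  (exists2 v, legal e S v
     & moves_left e false S = (moves_left e true (v |: S)).+1) /\
  (forall v, legal e S v ->
     (moves_left e true (v |: S)).+1 <= moves_left e false S).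
Proof.
move=> nS; have [v0 lv0] := legal_exists nS.
have mE : moves_left e false S
    = (\max_(v | legal e S v) moves_left e true (v |: S)).+1.
  rewrite /moves_left (legal_card lv0) /= (negPf nS); congr _.+1.
  apply: eq_bigr => v lv; congr game_value; apply: succn_inj.
  by rewrite -!(legal_card (e := e)).
rewrite mE; split; last by move=> v lv; rewrite ltnS; apply: leq_bigmax_cond.
have : 0 < #|legal e S| by apply/card_gt0P; exists v0.
by case/(eq_bigmax_cond (fun v => moves_left e true (v |: S))) => v lv ->;
  exists v.
Qed.

Definition cycle_adj (n : nat) (i j : 'I_n) : bool :=
  (j == i.+1 %[mod n]) || (i == j.+1 %[mod n]).

Definition complete_bipartite (m n : nat) : rel ('I_m + 'I_n) :=
  fun x y => match x, y with
             | inl _, inr _ | inr _, inl _ => true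
             | _, _ => false
             end.

(* The vertices [a_i] and [b_i] are [(false, i)] and [(true, i)].            *)
Definition prism_adj : rel (bool * 'I_3) :=
  fun x y => if x.1 == y.1 then x.2 != y.2 else x.2 == y.2.

Definition edges_adj (n : nat) (s : seq (nat * nat)) : rel 'I_n :=
  fun i j => ((val i, val j) \in s) || ((val j, val i) \in s).

(* The pentagon 0-1-2-3-4 plus a vertex 5 adjacent to the vertices listed in *)
(* the name.                                                                 *)
Definition edges_24 : seq (nat * nat) :=
  [:: (0, 1); (1, 2); (2, 3); (3, 4); (4, 0); (4, 5); (5, 2)].
Definition edges_124 : seq (nat * nat) := rcons edges_24 (1, 5).
Definition edges_234 : seq (nat * nat) := rcons edges_24 (5, 3).

(* Outer 5-cycle, inner pentagram, and spokes.                               *)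
Definition petersen_adj : rel (bool * 'I_5) :=
  fun x y => match x, y with
             | (false, i), (false, j) => cycle_adj i j
             | (true, i), (true, j) =>
                 (j == i + 2 %[mod 5]) || (i == j + 2 %[mod 5])
             | (_, i), (_, j) => i == j
             end.

(* Main.v *)
Require Import Defs.
From mathcomp Require Import all_boot zify.

Set Implicit Arguments.
Unset Strict Implicit.
Unset Printing Implicit Defensive.

(** In a graph of diameter two every open neighbourhood is a dominating set.
    Let [D] be the maximum degree and [n] the order.  If [u] vertices are
    undominated and [x] is one of them, the at most [D] neighbours of [x]
    dominate all of them and each dominates [x]; so some vertex dominates at
    least [1 + (u - 1) / D] undominated vertices.  In particular Dominator can
    dominate two as long as [u >= 2] and three as long as [u >= D + 2], and
    Staller always dominates at least one.  This gives the bounds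
    [(2 u + 1) / 3] ([moves_third]) and [(3 u + D + 3) / 6] ([moves_half]) on
    the number of remaining moves with Dominator to move.

    Dominator opens with a vertex [d] of degree [D]; if [n = D + 1] the game is
    over, and otherwise Staller's answer leaves at most [n - D - 2] undominated
    vertices.  The second bound then shows that the game takes fewer than
    [n / 2] moves, rounded up, if [D >= 5], or if [D = 4] and [n] is odd.  Since
    [n <= D ^ 2 + 1] by Moore's bound, finitely many pairs [(n, D)] remain, and
    the greedy estimates settle all of them but the following.

    - [(4, 2)], [(5, 2)], [(6, 3)], [(8, 3)], [(9, 3)]: all graphs are
      enumerated, row by row of the adjacency matrix ([all_graphs]), and for
      each graph of diameter two either the game is played out
      ([ends_within]) or an isomorphism to an extremal graph is found
      ([extends_to_iso]).  Moore's bound makes the graphs cubic when [n] is 8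
      or 9.
    - [(10, 3)]: equality holds in Moore's bound, which fixes four rows of the
      adjacency matrix; only the Petersen graph arises.
    - [(14, 4)]: if eight vertices are undominated after the first round, double
      counting gives Dominator a move that dominates four of them
      ([outcome_14_4]).
    - [(10, 4)]: unless opening with [d] is good enough, the undominated set after
      the first round induces two disjoint edges, and its surroundings are so
      constrained that the graphs can be enumerated ([outcome_10_4]).

    Conversely, the game on each of the eight graphs is evaluated on its
    adjacency matrix, which an isomorphism preserves ([game_iso]). *)

(** * Greedy bounds for Dominator *)

Section Graph.

Variables (T : finType) (e : rel T).

(** The open neighbourhood. *)
Definition nbhd (v : T) : {set T} := [set u | e v u].
(** The vertices not yet dominated once [S] has been selected. *)
Definition undom (S : {set T}) : {set T} := ~: dominated e S.
(** The number of vertices newly dominated by [v] when [S] has been selected;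
    [v] is a legal move exactly when it is positive. *)
Definition gain (S : {set T}) (v : T) : nat := #|cl_nbhd e v :&: undom S|.

Lemma undom0 : undom set0 = setT.
Proof. by rewrite /undom /dominated big_set0 setC0. Qed.

Lemma dominatedU1 S v : dominated e (v |: S) = cl_nbhd e v :|: dominated e S.
Proof.
apply/setP=> u; rewrite in_setU; apply/bigcupP/orP => [[w]|].
  rewrite in_setU1 => /orP[/eqP-> vu|wS wu]; [by left|].
  by right; apply/bigcupP; exists w.
case=> [vu|/bigcupP[w wS wu]]; first by exists v; rewrite // !inE eqxx.
by exists w; rewrite // !inE wS orbT.
Qed.

Lemma undomU1 S v : undom (v |: S) = undom S :\: cl_nbhd e v.
Proof. by rewrite /undom dominatedU1 setCU setIC setDE. Qed.

Lemma card_undomU1 S v : #|undom (v |: S)| = #|undom S| - gain S v.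
Proof. by rewrite undomU1 cardsD setIC. Qed.

Lemma dominatingE S : dominating e S = (undom S == set0).
Proof. by rewrite /dominating /undom -(inj_eq (@setC_inj T)) setCT. Qed.

Lemma legalE S v : legal e S v = (0 < gain S v).
Proof.
rewrite /legal /gain /undom -setDE card_gt0; congr (~~ _).
by rewrite setD_eq0.
Qed.

(** One round of the game: Dominator selects [v] and Staller answers. *)
Lemma round S v k :
    (forall s, legal e (v |: S) s -> moves_left e true (s |: (v |: S)) <= k) ->
  legal e S v -> moves_left e true S <= k.+2.
Proof.
move=> Hs lv; have [dS|nS] := boolP (dominating e S).
  by rewrite moves_left_dominating.
have [_ /(_ v lv) le1] := moves_leftE_dom nS; apply: leq_trans le1 _.
rewrite ltnS; have [dvS|nvS] := boolP (dominating e (v |: S)).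
  by rewrite moves_left_dominating.
have [[s ls ->] _] := moves_leftE_stal nvS.
by rewrite ltnS Hs.
Qed.

(** In the round opened by [v] the undominated set loses [gain S v] vertices
    to Dominator and at least one more to Staller. *)
Lemma round_bound S v k :
    (forall S', #|undom S'| <= #|undom S| - (gain S v).+1 ->
       moves_left e true S' <= k) ->
  0 < gain S v -> moves_left e true S <= k.+2.
Proof.
rewrite -legalE => Hk; apply: round => s; rewrite legalE => ls.
by apply: Hk; rewrite !card_undomU1; lia.
Qed.

Hypotheses (esym : symmetric e) (eirr : irreflexive e).
(* The form in which diameter two is used: each open neighbourhood [nbhd x] is
   a dominating set. *)
Hypothesis nbhd_dom : forall x y, x != y -> exists2 w, e x w & y \in cl_nbhd e w.

Lemma card_cl_nbhd v : #|cl_nbhd e v| = #|nbhd v|.+1.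
Proof.
have -> : cl_nbhd e v = v |: nbhd v by apply/setP=> u; rewrite !inE.
by rewrite cardsU1 inE eirr.
Qed.

Lemma common_dominator x y : exists w, (x \in cl_nbhd e w) && (y \in cl_nbhd e w).
Proof.
have [->|/nbhd_dom[w xw wy]] := eqVneq x y; first by exists y; rewrite !inE eqxx.
by exists w; rewrite wy inE esym xw orbT.
Qed.

Lemma gain_ge2 S : 1 < #|undom S| -> exists v, 1 < gain S v.
Proof.
case/card_gt1P=> x [y [xU yU nxy]]; have [w /andP[xw yw]] := common_dominator x y.
by exists w; apply/card_gt1P; exists x, y; rewrite !inE in xU yU xw yw *; split;
  rewrite ?xU ?yU ?xw ?yw.
Qed.

Variable D : nat.
Hypothesis max_deg : forall v, #|nbhd v| <= D.

(** If no vertex dominates more than [m] vertices of [U], then the neighbours of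
    [x \in U], which together dominate [U] and each dominate [x], dominate at
    most [m.-1] other vertices of [U] each. *)
Lemma cover_bound (U : {set T}) m x : x \in U ->
  (forall v, #|cl_nbhd e v :&: U| <= m) -> #|U|.-1 <= #|nbhd x| * m.-1.
Proof.
move=> xU le_m; rewrite (cardsD1 x) xU add1n /=.
have sub : U :\ x \subset \bigcup_(w in nbhd x) ((cl_nbhd e w :&: U) :\ x).
  apply/subsetP=> y; rewrite !inE => /andP[nyx yU].
  have [|w xw yw] := nbhd_dom (x := x) (y := y); first by rewrite eq_sym.
  by apply/bigcupP; exists w; rewrite ?inE // nyx yU andbT /=; rewrite inE in yw.
apply: leq_trans (subset_leq_card sub) _.
have card_le : #|\bigcup_(w in nbhd x) ((cl_nbhd e w :&: U) :\ x)|
    <= \sum_(w in nbhd x) #|(cl_nbhd e w :&: U) :\ x|.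
  elim/big_rec2: _ => [|w A B _ IH]; first by rewrite cards0.
  by rewrite cardsU; lia.
apply: leq_trans card_le _; rewrite -sum_nat_const; apply: leq_sum => w.
rewrite inE => xw; have := le_m w; rewrite (cardsD1 x) !inE esym xw orbT xU /=.
lia.
Qed.

Lemma gain_large S m : D * m + 1 < #|undom S| -> exists v, m.+1 < gain S v.
Proof.
move=> ltU; have /set0Pn[x xU] : undom S != set0 by rewrite -card_gt0; lia.
suff : ~~ [forall v, gain S v <= m.+1].
  by case/forallPn=> v; rewrite -ltnNge; exists v.
apply/negP=> /forallP /(cover_bound xU) /=.
by have := leq_mul (max_deg x) (leqnn m); lia.
Qed.

(** Moore's bound at the vertex [x]. *)
Lemma order_bound x : 1 < #|T| -> #|T| <= #|nbhd x| * D + 1.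
Proof.
move=> T1; have := @cover_bound setT D.+1 x (in_setT x); rewrite cardsT /=.
suff H v : #|cl_nbhd e v :&: setT| <= D.+1 by move/(_ H); lia.
by rewrite setIT card_cl_nbhd ltnS max_deg.
Qed.

(** Two undominated vertices have a common dominator, so each round removes
    three undominated vertices until at most two are left. *)
Lemma moves_third S : 3 * moves_left e true S <= 2 * #|undom S| + 1.
Proof.
have [m] := ubnP #|undom S|; elim: m => // m IH in S *; rewrite ltnS => leU.
have [dS|nS] := boolP (dominating e S); first by rewrite moves_left_dominating.
suff : moves_left e true S <= (2 * #|undom S| + 1) %/ 3 by lia.
have U0 : 0 < #|undom S| by move: nS; rewrite dominatingE -cards_eq0; lia.
have [v v1 v2] : exists2 v, 0 < gain S v & (1 < gain S v) || (#|undom S| <= 1).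
  have [U1|/gain_ge2[v v2]] := leqP #|undom S| 1; last by exists v; lia.
  by have [v] := legal_exists nS; rewrite legalE; exists v; rewrite ?orbT.
have [geU|ltU] := leqP #|undom S| (gain S v).
  have [_] := moves_leftE_dom nS; move/(_ v); rewrite legalE => /(_ v1).
  rewrite [moves_left e false _]moves_left_dominating; first by lia.
  by rewrite dominatingE -cards_eq0 card_undomU1; lia.
have leB : moves_left e true S <= ((2 * (#|undom S| - 3) + 1) %/ 3).+2.
  apply: (@round_bound _ v) => [S' leS'|]; last by lia.
  by have := IH S'; lia.
lia.
Qed.

(** While more than [D + 1] vertices are undominated, Dominator can dominate
    three of them, so that a round removes four; [moves_third] takes over
    afterwards. *)
Lemma moves_half S : 1 < D -> 6 * moves_left e true S <= 3 * #|undom S| + D + 3.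
Proof.
move=> D1; have [m] := ubnP #|undom S|; elim: m => // m IH in S *; rewrite ltnS => leU.
have [U1|U1] := leqP #|undom S| (D + 1); first by have := moves_third S; lia.
have [v v2] := @gain_large S 1 ltac:(lia).
suff : moves_left e true S <= ((3 * (#|undom S| - 4) + D + 3) %/ 6).+2 by lia.
apply: (@round_bound _ v) => [S' leS'|]; last by lia.
by have := IH S'; lia.
Qed.

End Graph.

(** * Games, isomorphisms and enumeration on adjacency matrices *)

Lemma card_listing (T : finType) (s : seq T) :
  uniq s -> (forall x, x \in s) -> #|T| = size s.
Proof.
by move=> us fulls; rewrite -(card_uniqP us); apply: eq_card => x; rewrite fulls.
Qed.

(** The rows of the adjacency matrix of [e] along the listing [s]. *)
Definition adj_rows (T : Type) (e : rel T) (s : seq T) : seq (seq bool) :=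
  [seq [seq e x y | y <- s] | x <- s].

Definition entry (M : seq (seq bool)) (i j : nat) : bool :=
  nth false (nth [::] M i) j.

(** Row [i] dominates column [j]. *)
Definition covers (M : seq (seq bool)) (i j : nat) : bool :=
  (i == j) || entry M i j.

(** Decides on an adjacency matrix whether the game ends in at most [k] moves
    when [U] lists the undominated indices and [dom] tells who is to move; see
    [ends_withinE].  The conditionals, rather than boolean connectives, keep
    eager evaluation from exploring illegal moves. *)
Fixpoint ends_within (M : seq (seq bool)) (k : nat) (dom : bool) (U : seq nat) :=
  if U is [::] then true else if k is k'.+1 then
    if dom then
      has (fun v => if has (covers M v) U then
             ends_within M k' false [seq u <- U | ~~ covers M v u] else false)
          (iota 0 (size M))
    else
      all (fun v => if has (covers M v) U then
             ends_within M k' true [seq u <- U | ~~ covers M v u] else true)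
          (iota 0 (size M))
  else false.

Section Game.
Variables (T : finType) (e : rel T) (s : seq T).
Hypotheses (us : uniq s) (fulls : forall x, x \in s).
Variable x0 : T.

Let M := adj_rows e s.
Let v_ i := nth x0 s i.

Lemma entryE i j : i < size s -> j < size s -> entry M i j = e (v_ i) (v_ j).
Proof.
by move=> li lj; rewrite /entry (nth_map x0) // (nth_map x0).
Qed.

Lemma coversE i j : i < size s -> j < size s ->
  covers M i j = (v_ j \in cl_nbhd e (v_ i)).
Proof.
by move=> li lj; rewrite /covers entryE // inE [v_ j == _]eq_sym nth_uniq.
Qed.

Lemma undom_rows_filter S v : v < size s ->
  [seq u <- [seq i <- iota 0 (size s) | v_ i \in undom e S] | ~~ covers M v u]
  = [seq i <- iota 0 (size s) | v_ i \in undom e (v_ v |: S)].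
Proof.
move=> lv; rewrite -filter_predI; apply: eq_in_filter => i.
by rewrite mem_iota add0n => /andP[_ li] /=; rewrite undomU1 in_setD coversE.
Qed.

Lemma legal_rows S v : v < size s ->
  has (covers M v) [seq i <- iota 0 (size s) | v_ i \in undom e S]
  = legal e S (v_ v).
Proof.
move=> lv; rewrite legalE card_gt0; apply/hasP/set0Pn => [[u]|[x]].
  rewrite mem_filter mem_iota => /andP[uU /= lu] cvu.
  by exists (v_ u); rewrite inE uU andbT -coversE.
rewrite inE => /andP[xv xU]; have lx := fulls x.
exists (index x s); first by rewrite mem_filter mem_iota /v_ nth_index // xU index_mem.
by rewrite coversE ?index_mem // /v_ nth_index.
Qed.

Lemma ends_withinE k dom S :
  ends_within M k dom [seq i <- iota 0 (size s) | v_ i \in undom e S]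
  = (moves_left e dom S <= k).
Proof.
have sM : size M = size s by rewrite size_map.
have idx x : exists2 i, i < size s & x = v_ i.
  by exists (index x s); rewrite ?index_mem // /v_ nth_index.
elim: k dom S => [|k IH] dom S /=; set U := [seq _ <- _ | _];
  have UE : (U == [::]) = dominating e S.
- rewrite dominatingE -(negbK (U == _)) -has_filter; apply/hasPn/eqP => [H|-> i _];
    last by rewrite inE.
  apply/setP=> x; have [i li ->] := idx x; rewrite in_set0; apply/negbTE/H.
  by rewrite mem_iota.
- case: (boolP (dominating e S)) UE => [dS /eqP->|nS /eqP nU].
    by rewrite moves_left_dominating.
  have -> : (if U is [::] then true else false) = false by case: U nU.
  case: dom; have [[v _ ->]] := moves_leftE_dom nS; first by [].
  by have [[w _ ->]] := moves_leftE_stal nS.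
- rewrite dominatingE -(negbK (U == _)) -has_filter; apply/hasPn/eqP => [H|-> i _];
    last by rewrite inE.
  apply/setP=> x; have [i li ->] := idx x; rewrite in_set0; apply/negbTE/H.
  by rewrite mem_iota.
case: (boolP (dominating e S)) UE => [dS /eqP->|nS /eqP nU].
  by rewrite moves_left_dominating.
set A := (X in if dom then X else _); set B := (X in if dom then _ else X).
have -> : (if U is [::] then true else if dom then A else B) =
  if dom then A else B by case: (U) nU.
rewrite {}/A {}/B sM.
case: dom.
  have [[v lv vE] min_le] := moves_leftE_dom nS; apply/hasP/idP => [[i]|].
    rewrite mem_iota add0n /U => /= li; rewrite legal_rows //.
    case: ifP => // li'; rewrite undom_rows_filter // IH => le_k.
    by apply: leq_trans (min_le _ li') _.
  rewrite vE ltnS; have [i li iE] := idx v; rewrite iE -IH => H.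
  by exists i; rewrite ?mem_iota // /U legal_rows // -iE lv undom_rows_filter ?iE.
have [[v lv vE] max_le] := moves_leftE_stal nS; apply/allP/idP => [H|le_k i].
  have [i li iE] := idx v; have := H i; rewrite mem_iota /U legal_rows //.
  by rewrite -iE lv undom_rows_filter // IH vE -iE; apply.
rewrite mem_iota add0n /U => /= li; rewrite legal_rows //.
case: ifP => // li'; rewrite undom_rows_filter // IH.
by have := max_le _ li'; lia.
Qed.

Lemma game_within k :
  ends_within M k true (iota 0 (size s)) = (game_dom_number e <= k).
Proof.
rewrite /game_dom_number -ends_withinE; congr ends_within.
by rewrite (@eq_filter _ _ predT) ?filter_predT // => i; rewrite undom0 inE.
Qed.

End Game.

(** [p] lists the images, as indices of [N], of the first [size p] indices of
    [M]; the function searches for [k] further images that respect the lower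
    triangles of the two matrices. *)
Fixpoint extends_to_iso (N M : seq (seq bool)) (k : nat) (p : seq nat) : bool :=
  if k is k'.+1 then
    has (fun i => if i \in p then false else
           if all (fun j => entry N i (nth 0 p j) == entry M (size p) j)
                (iota 0 (size p))
           then extends_to_iso N M k' (rcons p i) else false)
        (iota 0 (size N))
  else true.

Lemma extends_to_isoP N M k p : extends_to_iso N M k p ->
  (forall i j, j < i < size p -> entry N (nth 0 p i) (nth 0 p j) = entry M i j) ->
  uniq p -> all (fun i => i < size N) p ->
  exists q, [/\ size q = size p + k, uniq q, all (fun i => i < size N) q
   & forall i j, j < i < size q -> entry N (nth 0 q i) (nth 0 q j) = entry M i j].
Proof.
elim: k p => [|k IH] p /=; first by exists p; rewrite addn0.
case/hasP=> i; rewrite mem_iota add0n => /= li; case: ifP => // /negbT ip.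
case: ifP => // /allP Hi Hk Hp up lp.
have [|||q []] := IH _ Hk; rewrite ?rcons_uniq ?ip ?all_rcons ?li //.
  move=> a b; rewrite size_rcons ltnS => /andP[ba]; rewrite leq_eqVlt.
  rewrite !nth_rcons => /predU1P[aE|la].
    rewrite aE ltnn eqxx -aE ba aE; apply/eqP/Hi.
    by rewrite mem_iota /= -aE.
  by rewrite la (ltn_trans ba la); apply: Hp; rewrite ba.
by rewrite size_rcons addSnnS; exists q.
Qed.

Lemma graph_iso_rows (T U : finType) (e : rel T) (f : rel U)
    (s : seq T) (t : seq U) :
  symmetric e -> irreflexive e -> symmetric f -> irreflexive f ->
  uniq s -> (forall x, x \in s) -> uniq t -> (forall y, y \in t) ->
  size s = size t ->
  extends_to_iso (adj_rows f t) (adj_rows e s) (size s) [::] ->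
  graph_iso e f.
Proof.
move=> es ei fs fi us fulls ut fullt st.
have [s0|s_gt0] := posnP (size s).
  have noT (x : T) : False by have := fulls x; rewrite (size0nil s0).
  have noU (y : U) : False by have := fullt y; rewrite (@size0nil _ t) // -st.
  move=> _; exists (fun x => match noT x with end); last by move=> x; case: (noT x).
  by exists (fun y => match noU y with end) => z; [case: (noT z) | case: (noU z)].
have x0 : T by case: (s) s_gt0 => // x.
have y0 : U by case: (t) st s_gt0 => [|y _ ->] // ->.
move=> /extends_to_isoP /(_ _ isT isT)[i j|q [sq uq lq Hq]].
  by rewrite ltn0 andbF.
rewrite size_map in lq.
rewrite add0n in sq.
have nq x : nth 0 q (index x s) < size t.
  by apply: (allP lq); rewrite mem_nth // sq index_mem.
pose h x := nth y0 t (nth 0 q (index x s)).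
have h_inj : injective h.
  move=> x y /eqP; rewrite nth_uniq ?nq // nth_uniq ?sq ?index_mem // => /eqP.
  by move/(congr1 (nth x0 s)); rewrite !nth_index.
exists h.
  apply: inj_card_bij => //.
  by rewrite (card_listing us fulls) (card_listing ut fullt) st.
have lt_case x y : index y s < index x s -> f (h x) (h y) = e x y.
  move=> lt_yx; have := Hq (index x s) (index y s).
  rewrite sq lt_yx index_mem fulls => /(_ isT).
  by rewrite !(entryE _ x0) ?(entryE _ y0) ?nq ?index_mem // !nth_index.
move=> x y; case: (ltngtP (index y s) (index x s)) => [/lt_case//|/lt_case|].
  by rewrite fs es.
by move/(congr1 (nth x0 s)); rewrite !nth_index // => ->; rewrite ei fi.
Qed.

(** All bit sequences of length [k]. *)
Fixpoint bit_rows (k : nat) : seq (seq bool) :=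
  if k is k'.+1 then
    [seq false :: r | r <- bit_rows k'] ++ [seq true :: r | r <- bit_rows k']
  else [:: [::]].

Lemma mem_bit_rows r : r \in bit_rows (size r).
Proof.
have inj c : injective (cons c : seq bool -> _) by move=> ? ? [].
by elim: r => [|[] r IH] //=; rewrite mem_cat (mem_map (inj _)) IH ?orbT.
Qed.

(** Tests all symmetric matrices with zero diagonal that extend the first rows
    [rows] by [k] rows with at least [lo] and at most [hi] ones: the next row is
    determined by [rows] and the diagonal up to its own index, hence only the
    rest [t] of it has to be enumerated. *)
Fixpoint all_graphs (test : seq (seq bool) -> bool) (lo hi k : nat)
    (rows : seq (seq bool)) : bool :=
  if k is k'.+1 then
    all (fun t =>
      let r := [seq nth false q (size rows) | q <- rows] ++ false :: t in
      if lo <= count id r <= hi then all_graphs test lo hi k' (rcons rows r)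
      else true) (bit_rows k')
  else test rows.

Lemma all_graphsP test lo hi (rows M : seq (seq bool)) :
  let n := size (rows ++ M) in
  all_graphs test lo hi (size M) rows ->
  all (fun r => lo <= count id r <= hi) M ->
  (forall i j, i < j < n -> entry (rows ++ M) i j = entry (rows ++ M) j i) ->
  (forall i, i < n -> entry (rows ++ M) i i = false) ->
  all (fun r => size r == n) (rows ++ M) ->
  test (rows ++ M).
Proof.
elim: M rows => [|r M IH] rows /=; first by rewrite cats0.
move=> /allP H /andP[ar aM] symM irrM szM.
have sr : size r = size rows + (size M).+1.
  by have := allP szM r; rewrite mem_cat inE eqxx orbT size_cat => /(_ isT)/eqP.
have lt_size : size rows < size (rows ++ r :: M) by rewrite size_cat /=; lia.
have rE : r = [seq nth false q (size rows) | q <- rows]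
               ++ false :: drop (size rows).+1 r.
  rewrite -[LHS](cat_take_drop (size rows)); congr (_ ++ _).
    have st : size (take (size rows) r) = size rows by rewrite size_takel ?sr ?leq_addr.
    apply: (@eq_from_nth _ false); rewrite st ?size_map // => i li.
    rewrite (nth_map [::]) // nth_take //.
    have := symM i (size rows); rewrite li lt_size /entry !nth_cat li ltnn subnn.
    by move=> /(_ isT) /= ->.
  rewrite (drop_nth false); last by lia.
  by have := irrM _ lt_size; rewrite /entry nth_cat ltnn subnn /= => ->.
have := H (drop (size rows).+1 r).
have <- : size (drop (size rows).+1 r) = size M by rewrite size_drop sr; lia.
rewrite mem_bit_rows /= -rE ar => /(_ isT).
have -> : size (drop (size rows).+1 r) = size M by rewrite size_drop sr; lia.
by move/IH; rewrite cat_rcons; apply.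
Qed.

(** Any two indices have a common dominator. *)
Definition rows_diam2 (M : seq (seq bool)) : bool :=
  all (fun i => all (fun j =>
     (i <= j) || has (fun w => if covers M w i then covers M w j else false)
       (iota 0 (size M))) (iota 0 (size M))) (iota 0 (size M)).

Section Search.
Variables (T : finType) (e : rel T) (s : seq T).
Hypotheses (us : uniq s) (fulls : forall x, x \in s) (es : symmetric e).
Hypothesis common_dom :
  forall x y, exists w, (x \in cl_nbhd e w) && (y \in cl_nbhd e w).

Lemma rows_diam2_adj : rows_diam2 (adj_rows e s).
Proof.
case defs: s => [//|x0 s']; rewrite -defs {s' defs}.
have sM : size (adj_rows e s) = size s by rewrite size_map.
apply/allP=> i; rewrite sM mem_iota => /= li.
apply/allP=> j; rewrite mem_iota => /= lj; apply/orP; right.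
have [w /andP[wi wj]] := common_dom (nth x0 s i) (nth x0 s j).
apply/hasP; exists (index w s); first by rewrite mem_iota index_mem fulls.
by rewrite !(coversE _ us x0) ?index_mem ?nth_index // wi.
Qed.

Lemma row_degree x : count id [seq e x y | y <- s] = #|nbhd e x|.
Proof.
rewrite count_map -size_filter -(card_uniqP (filter_uniq _ us)).
by apply: eq_card => y; rewrite mem_filter fulls andbT /= inE.
Qed.

(** A test passed by all matrices of diameter two that extend the first [m] rows
    of the adjacency matrix of [e] is passed by that matrix. *)
Lemma all_graphs_adj test lo hi m :
  irreflexive e -> (forall v, lo <= #|nbhd e v| <= hi) -> m <= size s ->
  all_graphs (fun M => if rows_diam2 M then test M else true) lo hi
    (size s - m) (take m (adj_rows e s)) ->
  test (adj_rows e s).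
Proof.
move=> ei deg_bounds le_ms; set M := adj_rows e s.
have sM : size M = size s by rewrite size_map.
rewrite -sM -size_drop => /all_graphsP; rewrite /= cat_take_drop rows_diam2_adj; apply.
- by apply/allP=> r /mem_drop /mapP[x _ ->]; rewrite row_degree.
- rewrite sM => i j /andP[ij lj]; have x0 : T by case: (s) lj.
  by rewrite !(entryE _ x0) ?(ltn_trans ij).
- rewrite sM => i li; have x0 : T by case: (s) li.
  by rewrite (entryE _ x0).
by apply/allP=> r /mapP[x _ ->]; rewrite sM size_map.
Qed.
End Search.

(** * The eight extremal graphs *)

Lemma uniq_full (T : finType) (s : seq T) :
  uniq s -> #|T| <= size s -> forall x, x \in s.
Proof.
move=> us le_s x; have sub : {subset s <= enum T} by move=> y; rewrite mem_enum.
have [_ ->] := uniq_min_size us sub ltac:(by rewrite -cardE).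
by rewrite mem_enum.
Qed.

(** The test run on the matrices: either the game takes fewer than half of the
    vertices, rounded up, or the graph is isomorphic to one in the list [L]. *)
Definition few_moves_or_iso (L : seq (seq (seq bool))) (M : seq (seq bool)) :=
  if ends_within M (uphalf (size M)).-1 true (iota 0 (size M)) then true
  else has (fun N => extends_to_iso N M (size M) [::]) L.

Lemma few_moves_or_isoP (T : finType) (e : rel T) (s : seq T) L :
  0 < #|T| -> uniq s -> (forall x, x \in s) ->
  few_moves_or_iso L (adj_rows e s) ->
  game_dom_number e < uphalf #|T|
  \/ exists2 N, N \in L & extends_to_iso N (adj_rows e s) (size s) [::].
Proof.
move=> /card_gt0P[x0 _] us fulls; rewrite /few_moves_or_iso size_map.
rewrite (card_listing us fulls).
have s_gt0 : 0 < size s by case: (s) (fulls x0).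
case: ifP => [|_ /hasP]; last by right.
rewrite (game_within _ us fulls x0); left; lia.
Qed.

(** [t] lists distinct vertices on which [f] is a graph whose game takes exactly
    half of the vertices, rounded up. *)
Definition sporadic_listing (U : eqType) (f : rel U) (t : seq U) : bool :=
  let N := adj_rows f t in let k := uphalf (size t) in
  [&& uniq t, all (fun x => ~~ f x x) t,
      all (fun x => all (fun y => f x y == f y x) t) t,
      ends_within N k true (iota 0 (size t)),
      ~~ ends_within N k.-1 true (iota 0 (size t)) & 0 < size t].

Section Listing.
Variables (U : finType) (f : rel U) (t : seq U).
Hypotheses (ok : sporadic_listing f t) (cardU : #|U| = size t).

Lemma listing_uniq : uniq t. Proof. by case/and3P: ok. Qed.

Lemma listing_full y : y \in t.
Proof. by apply: (uniq_full listing_uniq); rewrite cardU. Qed.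

Lemma listing_irr : irreflexive f.
Proof.
by case/and3P: ok => _ /allP H _ x; apply/negbTE/H/listing_full.
Qed.

Lemma listing_sym : symmetric f.
Proof.
case/and4P: ok => _ _ /allP H _ x y; apply/eqP.
exact: (allP (H _ (listing_full x)) _ (listing_full y)).
Qed.

Lemma listing_game : game_dom_number f = uphalf #|U|.
Proof.
case/and5P: ok => _ _ _ le_k /andP[gt_k t_gt0].
have y0 : U by case: (t) t_gt0.
move: le_k gt_k; rewrite !(game_within _ listing_uniq listing_full y0) cardU.
lia.
Qed.

Lemma listing_iso (T : finType) (e : rel T) (s : seq T) :
  symmetric e -> irreflexive e -> uniq s -> (forall x, x \in s) ->
  size s = size t -> extends_to_iso (adj_rows f t) (adj_rows e s) (size s) [::] ->
  graph_iso e f.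
Proof.
move=> es ei us fulls st; apply: graph_iso_rows => //;
  [exact: listing_sym|exact: listing_irr|exact: listing_uniq|exact: listing_full].
Qed.

(** A listing pulled back along an isomorphism has the same adjacency matrix,
    which determines the game domination number. *)
Lemma game_iso (T : finType) (e : rel T) :
  graph_iso e f -> game_dom_number e = uphalf #|T|.
Proof.
case=> h [g gK hK] hf; have g_inj := can_inj hK.
have cardT : #|T| = #|U| by apply: bij_eq_card (Bijective gK hK).
rewrite cardT -listing_game.
have rows_eq : adj_rows e (map g t) = adj_rows f t.
  rewrite /adj_rows -map_comp; apply: eq_map => x /=.
  by rewrite -map_comp; apply: eq_map => y /=; rewrite -hf !hK.
have us : uniq (map g t) by rewrite (map_inj_uniq g_inj) listing_uniq.
have fulls x : x \in map g t by rewrite -(gK x) map_f ?listing_full.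
have [_ _ _ _ /andP[_ t_gt0]] := and5P ok.
have y0 : U by case: (t) t_gt0.
have same k : (game_dom_number e <= k) = (game_dom_number f <= k).
  rewrite -(game_within _ us fulls (g y0)) rows_eq size_map.
  by rewrite (game_within _ listing_uniq listing_full y0).
by apply/eqP; rewrite eqn_leq same leqnn -same leqnn.
Qed.
End Listing.

(* Explicit ordinals, since the enumeration of an ordinal type does not
   evaluate to constructors. *)
Definition ords3 : seq 'I_3 :=
  [:: @Ordinal 3 0 isT; @Ordinal 3 1 isT; @Ordinal 3 2 isT].
Definition ords4 : seq 'I_4 :=
  [:: @Ordinal 4 0 isT; @Ordinal 4 1 isT; @Ordinal 4 2 isT; @Ordinal 4 3 isT].
Definition ords5 : seq 'I_5 :=
  [:: @Ordinal 5 0 isT; @Ordinal 5 1 isT; @Ordinal 5 2 isT; @Ordinal 5 3 isT;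
      @Ordinal 5 4 isT].
Definition ords6 : seq 'I_6 :=
  [:: @Ordinal 6 0 isT; @Ordinal 6 1 isT; @Ordinal 6 2 isT; @Ordinal 6 3 isT;
      @Ordinal 6 4 isT; @Ordinal 6 5 isT].

(** The vertices of the prism and of the Petersen graph, from those of one of
    their two cycles. *)
Definition two_copies (I : Type) (s : seq I) : seq (bool * I) :=
  [seq (false, i) | i <- s] ++ [seq (true, i) | i <- s].
Definition K33_verts : seq ('I_3 + 'I_3) := map inl ords3 ++ map inr ords3.

Lemma card_K33 : #|{: 'I_3 + 'I_3}| = size K33_verts.
Proof. by rewrite card_sum !card_ord. Qed.

Lemma card_two_copies k (s : seq 'I_k) :
  size s = k -> #|{: bool * 'I_k}| = size (two_copies s).
Proof.
by move=> sk; rewrite card_prod card_bool card_ord size_cat !size_map sk; lia.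
Qed.

Lemma C4_listing : sporadic_listing (@cycle_adj 4) ords4.
Proof. by vm_compute. Qed.
Lemma C5_listing : sporadic_listing (@cycle_adj 5) ords5.
Proof. by vm_compute. Qed.
Lemma K33_listing : sporadic_listing (@complete_bipartite 3 3) K33_verts.
Proof. by vm_compute. Qed.
Lemma prism_listing : sporadic_listing prism_adj (two_copies ords3).
Proof. by vm_compute. Qed.
Lemma edges_24_listing : sporadic_listing (@edges_adj 6 edges_24) ords6.
Proof. by vm_compute. Qed.
Lemma edges_124_listing : sporadic_listing (@edges_adj 6 edges_124) ords6.
Proof. by vm_compute. Qed.
Lemma edges_234_listing : sporadic_listing (@edges_adj 6 edges_234) ords6.
Proof. by vm_compute. Qed.
Lemma petersen_listing : sporadic_listing petersen_adj (two_copies ords5).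
Proof. by vm_compute. Qed.

(** Isomorphic to one of the eight extremal graphs. *)
Definition sporadic (T : finType) (e : rel T) : Prop :=
  graph_iso e (@cycle_adj 4) \/
  graph_iso e (@cycle_adj 5) \/
  graph_iso e (@complete_bipartite 3 3) \/
  graph_iso e prism_adj \/
  graph_iso e (@edges_adj 6 edges_24) \/
  graph_iso e (@edges_adj 6 edges_124) \/
  graph_iso e (@edges_adj 6 edges_234) \/
  graph_iso e petersen_adj.

Lemma sporadic_game (T : finType) (e : rel T) :
  sporadic e -> game_dom_number e = uphalf #|T|.
Proof.
have [c3 c5] := (card_two_copies (s := ords3) erefl,
                 card_two_copies (s := ords5) erefl).
case; first by apply: (game_iso C4_listing); rewrite card_ord.
case; first by apply: (game_iso C5_listing); rewrite card_ord.
case; first exact: (game_iso K33_listing card_K33).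
case; first exact: (game_iso prism_listing c3).
case; first by apply: (game_iso edges_24_listing); rewrite card_ord.
case; first by apply: (game_iso edges_124_listing); rewrite card_ord.
case; first by apply: (game_iso edges_234_listing); rewrite card_ord.
exact: (game_iso petersen_listing c5).
Qed.

(** * Enumeration of the small cases *)

(** All graphs of diameter two and order [n] with degrees between [lo] and [hi]
    and first adjacency rows [rows] pass the test [few_moves_or_iso L]. *)
Definition check_graphs L lo hi (n : nat) (rows : seq (seq bool)) :=
  all_graphs (fun M => if rows_diam2 M then few_moves_or_iso L M else true)
    lo hi (n - size rows) rows.

(** The row of a vertex of degree [D] listed first and followed by its
    neighbours. *)
Definition star_row (n D : nat) : seq bool :=
  false :: nseq D true ++ nseq (n - D.+1) false.

Definition order6_list :=
  [:: adj_rows (@complete_bipartite 3 3) K33_verts;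
      adj_rows prism_adj (two_copies ords3);
      adj_rows (@edges_adj 6 edges_24) ords6;
      adj_rows (@edges_adj 6 edges_124) ords6;
      adj_rows (@edges_adj 6 edges_234) ords6].
Definition petersen_list := [:: adj_rows petersen_adj (two_copies ords5)].

Lemma check_4_2 :
  check_graphs [:: adj_rows (@cycle_adj 4) ords4] 0 2 4 [:: star_row 4 2].
Proof. by vm_compute. Qed.
Lemma check_5_2 :
  check_graphs [:: adj_rows (@cycle_adj 5) ords5] 0 2 5 [:: star_row 5 2].
Proof. by vm_compute. Qed.
Lemma check_6_3 : check_graphs order6_list 0 3 6 [:: star_row 6 3].
Proof. by vm_compute. Qed.
Lemma check_8_3 : check_graphs [::] 3 3 8 [:: star_row 8 3].
Proof. by vm_compute. Qed.
(* No cubic graph has nine vertices, so this holds vacuously. *)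
Lemma check_9_3 : check_graphs [::] 3 3 9 [:: star_row 9 3].
Proof. by vm_compute. Qed.

(** The row of length ten with ones at the indices in [s]. *)
Definition row10 (s : seq nat) : seq bool := [seq i \in s | i <- iota 0 10].

(** A vertex, its three neighbours, then the pairs of further neighbours of
    these. *)
Lemma check_10_3 : check_graphs petersen_list 3 3 10
  [:: row10 [:: 1; 2; 3]; row10 [:: 0; 4; 5]; row10 [:: 0; 6; 7];
      row10 [:: 0; 8; 9]].
Proof. by vm_compute. Qed.
(** In order: [x1], [x2], [y1], [y2], [d], [p11], [p12], [p21], [p22], [s] as in
    the proof of [outcome_10_4].  The Petersen graph arises as well, with [d] of
    degree three. *)
Lemma check_10_4 : check_graphs petersen_list 3 4 10
  [:: row10 [:: 1; 5; 6]; row10 [:: 0; 7; 8]; row10 [:: 3; 5; 7];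
      row10 [:: 2; 6; 8]].
Proof. by vm_compute. Qed.

Lemma map_const (A : eqType) (B : eqType) (f : A -> B) c (s : seq A) :
  {in s, forall y, f y = c} -> map f s = nseq (size s) c.
Proof.
move=> fc; rewrite -(size_map f s); apply/all_pred1P/allP => _ /mapP[y ys ->].
by rewrite /= fc.
Qed.

Lemma seq3 (A : Type) (s : seq A) : size s = 3 -> exists a b c, s = [:: a; b; c].
Proof. by case: s => [|a [|b [|c []]]] // _; exists a, b, c. Qed.

Lemma seq2 (A : Type) (s : seq A) : size s = 2 -> exists a b, s = [:: a; b].
Proof. by case: s => [|a [|b []]] // _; exists a, b. Qed.

(* Proves a conjunction of inequalities from hypotheses, up to symmetry. *)
Ltac distinct :=
  rewrite /= ?inE ?negb_or; repeat (apply/andP; split);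
  solve [assumption | rewrite eq_sym; assumption | done].

(** * Graphs of given order and maximum degree *)

Section MaximumDegree.

Variables (T : finType) (e : rel T).
Hypotheses (esym : symmetric e) (eirr : irreflexive e).
Hypothesis nbhd_dom : forall x y, x != y -> exists2 w, e x w & y \in cl_nbhd e w.
Variables (D : nat) (d : T).
Hypothesis max_deg : forall v, #|nbhd e v| <= D.
Hypotheses (deg_d : #|nbhd e d| = D) (D_ge2 : 1 < D).

Local Notation n := #|T|.
Local Notation outcome := (game_dom_number e < uphalf n \/ sporadic e).

Lemma order_gt0 : 0 < n.
Proof. by apply/card_gt0P; exists d. Qed.

Lemma check_graphs_adj (s : seq T) L lo rows :
  uniq s -> size s = n -> size rows <= n ->
  (forall v, lo <= #|nbhd e v|) -> take (size rows) (adj_rows e s) = rows ->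
  check_graphs L lo D n rows ->
  game_dom_number e < uphalf n
  \/ exists2 N, N \in L & extends_to_iso N (adj_rows e s) n [::].
Proof.
move=> us sn le_rows min_deg rowsE H.
have fulls := uniq_full us ltac:(by rewrite sn).
have := few_moves_or_isoP (L := L) order_gt0 us fulls; rewrite sn; apply.
apply: (@all_graphs_adj _ e s us fulls esym (common_dominator esym nbhd_dom) _
  lo D (size rows)) => //; last by rewrite rowsE sn.
  by move=> v; rewrite min_deg max_deg.
by rewrite sn.
Qed.

(** A vertex of maximum degree, its neighbours, the other vertices. *)
Definition star_listing : seq T := d :: enum (nbhd e d) ++ enum (~: cl_nbhd e d).

Lemma star_listing_uniq : uniq star_listing.
Proof.
rewrite /= cat_uniq !enum_uniq mem_cat !mem_enum !inE eqxx eirr /= andbT.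
by apply/hasPn=> x; rewrite !mem_enum !inE negb_or => /andP[].
Qed.

Lemma size_star_listing : size star_listing = n.
Proof.
rewrite /= size_cat -!cardE deg_d -(cardsC (cl_nbhd e d)) card_cl_nbhd // deg_d.
by rewrite addSn.
Qed.

Lemma star_listing_row : take 1 (adj_rows e star_listing) = [:: star_row n D].
Proof.
rewrite /adj_rows /= take0 eirr map_cat /star_row; congr [:: _ :: _ ++ _].
  by rewrite (map_const (c := true)) -?cardE ?deg_d // => y; rewrite mem_enum inE.
rewrite (map_const (c := false)) => [|y]; last first.
  by rewrite mem_enum !inE negb_or => /andP[_ /negPf].
by rewrite -cardE cardsCs setCK card_cl_nbhd // deg_d.
Qed.

Lemma star_check L lo :
  (forall v, lo <= #|nbhd e v|) -> check_graphs L lo D n [:: star_row n D] ->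
  game_dom_number e < uphalf n
  \/ exists s : seq T, [/\ uniq s, size s = n &
       exists2 N, N \in L & extends_to_iso N (adj_rows e s) n [::]].
Proof.
move=> min_deg.
case/(check_graphs_adj (rows := [:: star_row n D]) star_listing_uniq
        size_star_listing order_gt0 min_deg star_listing_row).
  by left.
by move=> H; right; exists star_listing; rewrite star_listing_uniq size_star_listing.
Qed.

Lemma listing_iso_n (U : finType) (f : rel U) (t : seq U) (s : seq T) :
  sporadic_listing f t -> #|U| = size t -> size t = n -> uniq s -> size s = n ->
  extends_to_iso (adj_rows f t) (adj_rows e s) (size t) [::] -> graph_iso e f.
Proof.
move=> ok cU tn us sn; rewrite tn -{1}sn; apply: (listing_iso ok cU) => //.
  by apply: uniq_full us _; rewrite sn.
by rewrite sn.
Qed.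

Lemma outcome_4_2 : n = 4 -> D = 2 -> outcome.
Proof.
move=> n4 D2; have := @star_check [:: adj_rows (@cycle_adj 4) ords4] 0.
rewrite n4 D2 => /(_ (fun=> isT) check_4_2)[|[s [us sn [N]]]]; first by left.
rewrite inE => /eqP-> H; right; left.
by apply: (listing_iso_n C4_listing (card_ord _) _ us _ H); rewrite n4.
Qed.

Lemma outcome_5_2 : n = 5 -> D = 2 -> outcome.
Proof.
move=> n5 D2; have := @star_check [:: adj_rows (@cycle_adj 5) ords5] 0.
rewrite n5 D2 => /(_ (fun=> isT) check_5_2)[|[s [us sn [N]]]]; first by left.
rewrite inE => /eqP-> H; right; right; left.
by apply: (listing_iso_n C5_listing (card_ord _) _ us _ H); rewrite n5.
Qed.

Lemma outcome_6_3 : n = 6 -> D = 3 -> outcome.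
Proof.
move=> n6 D3; have := @star_check order6_list 0.
rewrite n6 D3 => /(_ (fun=> isT) check_6_3)[|[s [us sn [N]]]]; first by left.
rewrite !inE => N_in H; right; rewrite /sporadic; move: N_in H.
case/or4P=> [/eqP->|/eqP->|/eqP->|/orP[]/eqP->] H.
- do 2![right]; left.
  by apply: (listing_iso_n K33_listing card_K33 _ us _ H); rewrite n6.
- do 3![right]; left.
  by apply: (listing_iso_n prism_listing (card_two_copies (s := ords3) erefl)
                _ us _ H); rewrite n6.
- do 4![right]; left.
  by apply: (listing_iso_n edges_24_listing (card_ord _) _ us _ H); rewrite n6.
- do 5![right]; left.
  by apply: (listing_iso_n edges_124_listing (card_ord _) _ us _ H); rewrite n6.
do 6![right]; left.
by apply: (listing_iso_n edges_234_listing (card_ord _) _ us _ H); rewrite n6.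
Qed.

Lemma degree_bound x : n <= #|nbhd e x| * D + 1.
Proof.
apply: order_bound => //; have := max_card (nbhd e d); rewrite deg_d; lia.
Qed.

Lemma outcome_8_9_3 : n = 8 \/ n = 9 -> D = 3 -> outcome.
Proof.
move=> n89 D3; left; have := @star_check [::] 3.
have chk : check_graphs [::] 3 D n [:: star_row n D].
  by case: n89 => ->; rewrite D3; [exact: check_8_3|exact: check_9_3].
case=> [v||//|[s [_ _ []]]] //; have := degree_bound v; lia.
Qed.

Lemma petersen_outcome s lo hi rows :
  n = 10 -> D = hi -> uniq s -> size s = 10 -> size rows <= 10 ->
  (forall v, lo <= #|nbhd e v|) -> take (size rows) (adj_rows e s) = rows ->
  check_graphs petersen_list lo hi 10 rows -> outcome.
Proof.
move=> n10 <-; rewrite -n10 => us sn le_rows min_deg rowsE.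
case/(check_graphs_adj us sn le_rows min_deg rowsE); first by left.
case=> N; rewrite inE => /eqP-> H; right; do 7![right].
apply: (listing_iso_n petersen_listing (card_two_copies (s:=ords5) erefl) _ us sn);
  by rewrite -?[size _]n10.
Qed.

(** Equality in Moore's bound: the vertex [d], its neighbours and their further
    neighbours are pairwise distinct, as these ten terms list all vertices. *)
Lemma outcome_10_3 : n = 10 -> D = 3 -> outcome.
Proof.
move=> n10 D3.
have deg3 v : #|nbhd e v| = 3.
  by have := degree_bound v; have := max_deg v; lia.
have [a1 [a2 [a3 nd]]] : exists a b c, enum (nbhd e d) = [:: a; b; c].
  by apply: seq3; rewrite -cardE.
have edE x : e d x = (x \in [:: a1; a2; a3]) by rewrite -nd mem_enum inE.
have others a : e d a -> exists b c, forall x, e a x = (x \in [:: d; b; c]).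
  move=> da; have [|b [c bc]] := @seq2 _ (enum (nbhd e a :\ d)).
    rewrite -cardE; have := deg3 a; rewrite (cardsD1 d) inE esym da; lia.
  exists b, c => x; rewrite in_cons -bc mem_enum !inE.
  by have [->|//] := eqVneq x d; rewrite esym da.
have [b1 [c1 e1]] := others a1 ltac:(by rewrite edE !inE eqxx).
have [b2 [c2 e2]] := others a2 ltac:(by rewrite edE !inE eqxx orbT).
have [b3 [c3 e3]] := others a3 ltac:(by rewrite edE !inE eqxx !orbT).
pose s := [:: d; a1; a2; a3; b1; c1; b2; c2; b3; c3].
have fulls x : x \in s.
  have [<-|ndx] := eqVneq d x; first by rewrite in_cons eqxx.
  have [w] := nbhd_dom ndx; rewrite edE !inE.
  case/or3P=> /eqP-> /orP[/eqP->|]; rewrite ?eqxx ?orbT //.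
  - by rewrite e1 !inE => /or3P[] /eqP->; rewrite ?eqxx ?orbT.
  - by rewrite e2 !inE => /or3P[] /eqP->; rewrite ?eqxx ?orbT.
  by rewrite e3 !inE => /or3P[] /eqP->; rewrite ?eqxx ?orbT.
have us : uniq s.
  apply: (@leq_size_uniq _ (enum T)); rewrite ?enum_uniq //; last by rewrite -cardE n10.
have nth_in ks i : all (fun k => k < 10) ks -> i < 10 ->
    (nth d s i \in [seq nth d s k | k <- ks]) = (i \in ks).
  move=> /allP lt_ks li; apply/mapP/idP => [[k k_in /eqP]|]; last by exists i.
  have lk : k < size s by apply: lt_ks.
  by rewrite nth_uniq // => /eqP->.
have row v ks : all (fun k => k < 10) ks ->
    (forall x, e v x = (x \in [seq nth d s k | k <- ks])) ->
    [seq e v y | y <- s] = row10 ks.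
  move=> lt_ks ev; have {1}-> : s = mkseq (nth d s) 10 by rewrite mkseq_nth.
  rewrite -map_comp; apply/eq_in_map => i; rewrite mem_iota => /= li.
  by rewrite ev nth_in.
apply: (@petersen_outcome s 3 3 _ n10 D3 us erefl _ _ _ check_10_3) => //.
  by move=> v; rewrite deg3.
rewrite -(row d) // -(row a1) // -(row a2) // -(row a3) //.
Qed.

(** Dominator opens with the vertex [d] of maximum degree [D]; after Staller's
    answer at most [n - D - 2] vertices are undominated. *)
Lemma first_move k :
  (forall S, #|undom e S| <= n - D.+2 -> moves_left e true S <= k) ->
  game_dom_number e <= k.+2.
Proof.
have gain_d : gain e set0 d = D.+1.
  by rewrite /gain undom0 setIT card_cl_nbhd // deg_d.
move=> Hk; apply: (@round_bound _ e set0 d); last by rewrite gain_d.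
by move=> S; rewrite undom0 cardsT gain_d; apply: Hk.
Qed.

(** If the first bound fails, some answer [s] of Staller to [d] refutes it. *)
Lemma first_round k :
  game_dom_number e <= k.+2 \/
  exists2 s, legal e [set d] s & k < moves_left e true (s |: [set d]).
Proof.
have [s /andP[ls ms]|no_s] :=
  pickP (fun s => legal e [set d] s && (k < moves_left e true (s |: [set d]))).
  by right; exists s.
left; apply: (@round _ e set0 d); last first.
  by rewrite legalE /gain undom0 setIT card_cl_nbhd.
move=> s; rewrite setU0 => ls; have := no_s s; rewrite /= ls /=; lia.
Qed.

Lemma undom_first_le s : legal e [set d] s -> #|undom e (s |: [set d])| <= n - D.+2.
Proof.
rewrite legalE card_undomU1 -(setU0 [set d]) card_undomU1 undom0 cardsT.
by rewrite {2}/gain undom0 setIT card_cl_nbhd // deg_d; lia.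
Qed.

Lemma undom_first s x : x \in undom e (s |: [set d]) ->
  x \notin cl_nbhd e s /\ x \notin cl_nbhd e d.
Proof.
by rewrite undomU1 in_setD -(setU0 [set d]) undomU1 in_setD => /and3P[-> -> _].
Qed.

Lemma d_notin_undom s : d \notin undom e (s |: [set d]).
Proof. by rewrite undomU1 -(setU0 [set d]) undomU1 !inE eqxx !andbF. Qed.

(** If Staller's answer to [d] leaves eight undominated vertices [U] and no
    vertex dominates four of them, each vertex of [U], having degree four, has
    two neighbours among the five vertices outside [U] other than [d].  This
    makes 16 edges, whereas each of the five vertices has at most three
    neighbours in [U]. *)
Lemma outcome_14_4 : n = 14 -> D = 4 -> outcome.
Proof.
move=> n14 D4; left; rewrite n14.
have [le6|[s ls]] := first_round 4; first by lia.
rewrite ltnNge => /negP[]; have := undom_first_le ls; rewrite n14 D4.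
have := d_notin_undom s; set U := undom e _ => dU le8.
set S := s |: [set d] in U dU le8 *.
have third := moves_third esym nbhd_dom.
have [le6|gt6] := leqP #|U| 6; first by have := third S; rewrite -/U; lia.
have move v m : #|U| - m.+1 <= 3 -> m <= gain e S v -> 0 < m ->
    moves_left e true S <= 4.
  move=> le3 ge_m m_gt0; apply: (@round_bound _ e S v); last by lia.
  by move=> S' leS'; have := third S'; rewrite -/U in leS'; lia.
have [le7|gt7] := leqP #|U| 7.
  have [|v] := @gain_large _ e esym nbhd_dom D max_deg S 1; rewrite -/U; first by lia.
  by move=> v3; apply: (move v 3); lia.
have U8 : #|U| = 8 by lia.
have [v v4|small] := pickP (fun v => 3 < gain e S v).
  by apply: (move v 4); lia.
(* The five vertices: the neighbours of [d] and the vertex dominated by Staller. *)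
pose O := ~: (d |: U).
have cO : #|O| = 5 by have := cardsC (d |: U); rewrite cardsU1 dU U8 n14 -/O add1n; lia.
have trace v : #|cl_nbhd e v :&: U| <= 3 by have/negbT := small v; rewrite -leqNgt.
have far x : x \in U -> e x d = false.
  by case/undom_first => _; rewrite !inE negb_or esym => /andP[_ /negPf].
clearbody U.
have out x : x \in U -> 2 <= #|nbhd e x :&: O|.
  move=> xU; have := degree_bound x; rewrite -(cardsID O (nbhd e x)) n14 D4.
  have := trace x; rewrite (cardsD1 x) !inE eqxx xU /=.
  suff /subset_leq_card : nbhd e x :\: O \subset (cl_nbhd e x :&: U) :\ x by lia.
  apply/subsetP=> y; rewrite !inE negbK => /andP[dyU xy].
  have nyx : y != x by apply: contraTneq xy => ->; rewrite eirr.
  rewrite nyx xy orbT; case/predU1P: dyU xy => // -> xd.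
  by rewrite far in xd.
(* Double counting of the edges between [U] and [O]. *)
have : \sum_(x in U) #|nbhd e x :&: O| <= 15.
  have cardE' (A : {set T}) x : #|nbhd e x :&: A| = \sum_(v in A) e x v.
    by rewrite -sum1_card big_mkcond [RHS]big_mkcond; apply: eq_bigr => v _;
      rewrite !inE andbC; case: (v \in A); case: (e x v).
  under eq_bigr do rewrite cardE'.
  rewrite exchange_big /=; under eq_bigr do under eq_bigr do rewrite esym.
  under eq_bigr do rewrite -cardE'.
  apply: (@leq_trans (\sum_(v in O) 3)); last by rewrite sum_nat_const cO.
  apply: leq_sum => v _; apply: leq_trans (trace v); apply: subset_leq_card.
  by apply: setSI; apply/subsetP=> y; rewrite !inE => ->; rewrite orbT.
have : \sum_(x in U) 2 <= \sum_(x in U) #|nbhd e x :&: O| by apply: leq_sum.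
by rewrite sum_nat_const U8; lia.
Qed.

(** The game takes at most [2 + (3 (n - D - 2) + D + 3) / 6] moves. *)
Lemma outcome_large :
  4 < D \/ D = 4 /\ odd n -> n != D.+1 -> game_dom_number e < uphalf n.
Proof.
move=> HD nD; have leD : D.+1 <= n by rewrite -deg_d -(card_cl_nbhd eirr) max_card.
have := @first_move ((3 * (n - D.+2) + D + 3) %/ 6).
have H S : #|undom e S| <= n - D.+2 ->
    moves_left e true S <= (3 * (n - D.+2) + D + 3) %/ 6.
  by have := moves_half esym nbhd_dom max_deg S D_ge2; lia.
by move/(_ H); case: HD => [|[D4 odd_n]]; lia.
Qed.

(** Let [d] be Dominator's move and [s] an answer of Staller after which at
    least three more moves are needed.  Then four vertices [U] are undominated and no vertex
    dominates three of them, so distinct nonadjacent pairs of [U] have distinct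
    common neighbours, none of which lies in [U] or is [d] or [s]; only four
    vertices are left for this.  Hence [U] spans two disjoint edges [x1 x2] and
    [y1 y2], and the four vertices are the common neighbours [p_ij] of [x_i]
    and [y_j].  The graphs with this structure are enumerated by
    [check_10_4]. *)
Lemma outcome_10_4 : n = 10 -> D = 4 -> outcome.
Proof.
move=> n10 D4.
have deg3 v : 3 <= #|nbhd e v| by have := degree_bound v; lia.
have [le4|[s ls gt2]] := first_round 2; first by left; rewrite n10; lia.
have := undom_first_le ls; rewrite [in X in X -> _]n10 D4.
have := d_notin_undom s; have := @undom_first s.
set S := s |: [set d] in gt2 *.
have gainS v : gain e S v = #|cl_nbhd e v :&: undom e S| by [].
move: gainS; move defU: (undom e S) => U gainS far dU le4.
have third := moves_third esym nbhd_dom.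
have U4 : #|U| = 4 by have := third S; rewrite defU; lia.
have small v : #|cl_nbhd e v :&: U| <= 2.
  rewrite -gainS leqNgt; apply/negP=> v3; move: gt2; rewrite ltnNge => /negP[].
  apply: (@round_bound _ e S v); last by lia.
  by move=> S'; rewrite defU => leS'; have := third S'; lia.
(* No vertex dominates three vertices of [U]. *)
have pair v a b c : a \in U -> b \in U -> c \in U -> uniq [:: a; b; c] ->
    a \in cl_nbhd e v -> b \in cl_nbhd e v -> c \in cl_nbhd e v = false.
  move=> aU bU cU uabc av bv; apply/negP=> cv.
  suff : 2 < #|cl_nbhd e v :&: U| by rewrite ltnNge small.
  rewrite (_ : 3 = #|[:: a; b; c]|); last by rewrite (card_uniqP uabc).
  apply: subset_leq_card; apply/subsetP=> y; rewrite in_setI !in_cons orbF.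
  by case/or3P=> /eqP->; apply/andP.
have sU x : x \in U -> e s x = false.
  by case/far=> + _; rewrite !inE negb_or => /andP[_ /negPf].
have dnU x : x \in U -> e d x = false.
  by case/far=> _; rewrite !inE negb_or => /andP[_ /negPf].
have nsU : s \notin U by apply/negP=> /far[]; rewrite inE eqxx.
have nds : d != s.
  apply: contraTneq ls => <-; rewrite /legal negbK /dominated.
  by apply: (bigcup_sup d); rewrite inE.
(* The vertices that can be common neighbours of vertices of [U]. *)
pose O := ~: (d |: (s |: U)).
have cO : #|O| = 4.
  have := cardsC (d |: (s |: U)); rewrite cardsU1 in_setU1 negb_or nds dU.
  by rewrite cardsU1 nsU U4 n10 -/O !add1n; lia.
have dominator a b : a \in U -> b \in U -> a != b -> e a b = false ->
    exists2 v, v \in O & e v a && e v b.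
  move=> aU bU nab eab; have [v /andP[av bv]] := common_dominator esym nbhd_dom a b.
  have nav : v != a.
    by apply: contraTneq bv => ->; rewrite inE eab orbF eq_sym.
  have nbv : v != b by apply: contraTneq av => ->; rewrite inE esym eab orbF.
  have nvU : v \notin U.
    apply/negP=> vU; have vv : v \in cl_nbhd e v by rewrite inE eqxx.
    suff uabv : uniq [:: a; b; v] by rewrite (pair v a b v) in vv.
    by rewrite /= !inE negb_or nab eq_sym nav eq_sym nbv.
  have eva : e v a by move: av; rewrite inE eq_sym (negPf nav).
  have evb : e v b by move: bv; rewrite inE eq_sym (negPf nbv).
  exists v; rewrite ?eva ?evb // !inE !negb_or nvU andbT.
  by apply/andP; split; apply: contraTneq eva => ->; rewrite ?sU ?dnU.
have pairE v a b c : a \in U -> b \in U -> c \in U -> uniq [:: a; b; c] ->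
    e v a -> e v b -> e v c = false.
  move=> aU bU cU uabc va vb; apply/negbTE/negP=> vc.
  have : c \in cl_nbhd e v by rewrite inE vc orbT.
  by rewrite (pair v a b c) // inE ?va ?vb orbT.
have differ v w a b c : a \in U -> b \in U -> c \in U -> uniq [:: a; b; c] ->
    e v a -> e v b -> e w c -> v != w.
  move=> aU bU cU uabc va vb; apply: contraTneq => <-.
  by rewrite (pairE v a b c).
(* The edges inside [U] form a matching. *)
have noE p q r : p \in U -> q \in U -> r \in U -> uniq [:: p; q; r] ->
    e p q -> e p r = false.
  move=> pU qU rU upqr pq; apply/negbTE/negP=> pr.
  have rp : r \in cl_nbhd e p by rewrite inE pr orbT.
  by rewrite (pair p p q r) ?inE ?eqxx ?pq ?orbT in rp.
(* The five nonadjacent pairs in [U] would need five common neighbours in [O]. *)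
have no_star x a b c : x \in U -> a \in U -> b \in U -> c \in U ->
    uniq [:: x; a; b; c] -> e x a = false -> e x b = false -> e x c = false ->
    e a b = false -> e a c = false -> False.
  move=> xU aU bU cU; rewrite /= !inE !negb_or -!andbA.
  case/and5P=> nxa nxb nxc nab /and3P[nac nbc _] xa xb xc ab ac.
  have [q1 q1O /andP[q1x q1a]] := dominator x a xU aU nxa xa.
  have [q2 q2O /andP[q2x q2b]] := dominator x b xU bU nxb xb.
  have [q3 q3O /andP[q3x q3c]] := dominator x c xU cU nxc xc.
  have [q4 q4O /andP[q4a q4b]] := dominator a b aU bU nab ab.
  have [q5 q5O /andP[q5a q5c]] := dominator a c aU cU nac ac.
  suff : 4 < #|O| by rewrite cO.
  suff uq : uniq [:: q1; q2; q3; q4; q5].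
    rewrite (_ : 5 = #|[:: q1; q2; q3; q4; q5]|); last by rewrite (card_uniqP uq).
    apply: subset_leq_card; apply/subsetP=> y; rewrite !in_cons orbF.
    by case/or4P=> [/eqP->|/eqP->|/eqP->|/orP[]/eqP->].
  rewrite /= !inE !negb_or.
  rewrite (differ q1 q2 x a b) ?(differ q1 q3 x a c) ?(differ q1 q4 x a b)
    ?(differ q1 q5 x a c) ?(differ q2 q3 x b c) ?(differ q2 q4 x b a)
    ?(differ q2 q5 x b a) ?(differ q3 q4 x c a) ?(differ q3 q5 x c a)
    ?(differ q4 q5 a b c) //; distinct.
(* If [x] has no neighbour in [U], then, the other three vertices spanning at
   most one edge, one of them has no neighbour in [U] either. *)
have has_nbr x : x \in U -> exists2 y, y \in U & e x y.
  move=> xU; have [y /andP[yU xy]|no_nbr] := pickP (fun y => (y \in U) && e x y).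
    by exists y.
  have xN y : y \in U -> e x y = false by have := no_nbr y; case: (y \in U).
  have [|a [b [c abc]]] := @seq3 _ (enum (U :\ x)).
    by rewrite -cardE; have := U4; rewrite (cardsD1 x) xU; lia.
  have inU y : y \in [:: a; b; c] -> y \in U.
    by rewrite -abc mem_enum !inE => /andP[].
  have [aU bU cU] : [/\ a \in U, b \in U & c \in U].
    by split; apply: inU; rewrite !inE eqxx ?orbT.
  have ux : uniq [:: x; a; b; c].
    by rewrite -abc cons_uniq mem_enum !inE eqxx enum_uniq.
  have := ux; rewrite /= !inE !negb_or -!andbA.
  case/and5P=> nxa nxb nxc nab /and3P[nac nbc _].
  case ab : (e a b).
    case: (no_star x c a b); rewrite ?xN //; try distinct.
      by rewrite esym (noE a b c) //; distinct.
    by rewrite esym (noE b a c) 1?esym //; distinct.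
  case ac : (e a c).
    case: (no_star x b a c); rewrite ?xN // 1?esym //; try distinct.
    by rewrite (noE c a b) 1?esym //; distinct.
  by case: (no_star x a b c); rewrite ?xN.
have [x1 x1U] : exists x1, x1 \in U by apply/set0Pn; rewrite -card_gt0 U4.
have [x2 x2U x12] := has_nbr x1 x1U.
have n12 : x1 != x2 by apply: contraTneq x12 => <-; rewrite eirr.
have [y1] : exists y1, y1 \in U :\ x1 :\ x2.
  apply/set0Pn; rewrite -card_gt0; have := U4.
  by rewrite (cardsD1 x1) (cardsD1 x2 (U :\ x1)) x1U !inE eq_sym n12 x2U; lia.
rewrite !inE => /and3P[n21 n11 y1U].
have [y2 y2U y12] := has_nbr y1 y1U.
have ny : y1 != y2 by apply: contraTneq y12 => <-; rewrite eirr.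
have x1y1 : e x1 y1 = false by apply: (noE x1 x2 y1) => //; distinct.
have x2y1 : e x2 y1 = false by apply: (noE x2 x1 y1) => //; [distinct|rewrite esym].
have m1 : y2 != x1 by apply: contraTneq y12 => ->; rewrite esym x1y1.
have m2 : y2 != x2 by apply: contraTneq y12 => ->; rewrite esym x2y1.
have x1y2 : e x1 y2 = false by apply: (noE x1 x2 y2) => //; distinct.
have x2y2 : e x2 y2 = false by apply: (noE x2 x1 y2) => //; [distinct|rewrite esym].
have [p11 p11O /andP[p11x p11y]] := dominator x1 y1 x1U y1U ltac:(distinct) x1y1.
have [p12 p12O /andP[p12x p12y]] := dominator x1 y2 x1U y2U ltac:(distinct) x1y2.
have [p21 p21O /andP[p21x p21y]] := dominator x2 y1 x2U y1U ltac:(distinct) x2y1.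
have [p22 p22O /andP[p22x p22y]] := dominator x2 y2 x2U y2U ltac:(distinct) x2y2.
pose r := [:: x1; x2; y1; y2; d; p11; p12; p21; p22; s].
have inO v : v \in O -> [/\ v != d, v != s & v \notin U].
  by rewrite !inE !negb_or => /and3P.
have outU v u : v \notin U -> u \in U -> u != v.
  by move=> vU uU; apply: contraNneq vU => <-.
have ur : uniq r.
  have [[a1 b1 c1] [a2 b2 c2]] := (inO _ p11O, inO _ p12O).
  have [[a3 b3 c3] [a4 b4 c4]] := (inO _ p21O, inO _ p22O).
  have q1 : p11 != p12 by apply: (differ _ _ x1 y1 y2) => //; distinct.
  have q2 : p11 != p21 by apply: (differ _ _ x1 y1 x2) => //; distinct.
  have q3 : p11 != p22 by apply: (differ _ _ x1 y1 x2) => //; distinct.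
  have q4 : p12 != p21 by apply: (differ _ _ x1 y2 x2) => //; distinct.
  have q5 : p12 != p22 by apply: (differ _ _ x1 y2 x2) => //; distinct.
  have q6 : p21 != p22 by apply: (differ _ _ x2 y1 y2) => //; distinct.
  rewrite /= !inE !negb_or; repeat (apply/andP; split); try (apply: outU; assumption);
    distinct.
have e1 : [seq e x1 y | y <- r] = row10 [:: 1; 5; 6].
  rewrite /= eirr x12 x1y1 x1y2 !(esym x1) dnU // p11x p12x sU //.
  by rewrite (pairE p21 x2 y1 x1) ?(pairE p22 x2 y2 x1) //; distinct.
have e2 : [seq e x2 y | y <- r] = row10 [:: 0; 7; 8].
  rewrite /= eirr x2y1 x2y2 !(esym x2) x12 dnU // p21x p22x sU //.
  by rewrite (pairE p11 x1 y1 x2) ?(pairE p12 x1 y2 x2) //; distinct.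
have e3 : [seq e y1 y | y <- r] = row10 [:: 3; 5; 7].
  rewrite /= eirr y12 !(esym y1) x1y1 x2y1 dnU // p11y p21y sU //.
  by rewrite (pairE p12 x1 y2 y1) ?(pairE p22 x2 y2 y1) //; distinct.
have e4 : [seq e y2 y | y <- r] = row10 [:: 2; 6; 8].
  rewrite /= eirr !(esym y2) y12 x1y2 x2y2 dnU // p12y p22y sU //.
  by rewrite (pairE p11 x1 y1 y2) ?(pairE p21 x2 y1 y2) //; distinct.
pose rows := [:: row10 [:: 1; 5; 6]; row10 [:: 0; 7; 8]; row10 [:: 3; 5; 7];
                row10 [:: 2; 6; 8]].
have rowsE : take (size rows) (adj_rows e r) = rows.
  exact: (f_equal4 (fun a b c d => [:: a; b; c; d]) e1 e2 e3 e4).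
exact: (@petersen_outcome r 3 4 rows n10 D4 ur erefl isT deg3 rowsE check_10_4).
Qed.

(** The case distinction over the order [n] and the maximum degree [D]. *)
Lemma outcome_all : 2 < n -> outcome.
Proof.
move=> n3; have leD : D.+1 <= n by rewrite -deg_d -(card_cl_nbhd eirr) max_card.
have third := moves_third esym nbhd_dom.
have [nD|nD] := eqVneq n D.+1.
  (* The vertex [d] dominates the graph. *)
  left; have nd0 : ~~ dominating e set0.
    by rewrite dominatingE undom0 -card_gt0 cardsT; lia.
  have gd : gain e set0 d = D.+1.
    by rewrite /gain undom0 setIT card_cl_nbhd // deg_d.
  have [_ /(_ d)] := moves_leftE_dom nd0; rewrite legalE gd => /(_ isT).
  rewrite [moves_left e false _]moves_left_dominating.
    by rewrite /game_dom_number; lia.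
  by rewrite dominatingE -cards_eq0 card_undomU1 gd undom0 cardsT nD subnn.
have [D5|D4] := ltnP 4 D; first by left; apply: outcome_large => //; left.
have nD2 := degree_bound d; rewrite deg_d in nD2.
have [D2|D3|] := ltngtP D 3; last first.
- move=> D3.
  (* The order is at most ten by Moore's bound. *)
  have [n5|n5] := leqP n 5.
    left; suff: game_dom_number e <= 2 by lia.
    by apply: first_move => S'; have := third S'; lia.
  have [/outcome_6_3|n6] := eqVneq n 6; first exact.
  have [n7|n7] := eqVneq n 7.
    left; suff: game_dom_number e <= 3 by lia.
    by apply: first_move => S'; have := third S'; lia.
  have [/outcome_10_3|n10] := eqVneq n 10; first exact.
  by apply: outcome_8_9_3 => //; rewrite D3 in nD2; lia.
- have {}D4 : D = 4 by lia.
  have [odd_n|even_n] := boolP (odd n).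
    by left; apply: outcome_large => //; right.
  have [/outcome_10_4|n10] := eqVneq n 10; first exact.
  have [/outcome_14_4|n14] := eqVneq n 14; first exact.
  rewrite D4 in nD2; left.
  have cover m k S : D * m + 1 < #|undom e S| ->
      2 * (#|undom e S| - m.+3) < 3 * k.+1 - 1 -> moves_left e true S <= k.+2.
    move=> /(gain_large esym nbhd_dom max_deg)[v vm] le_k.
    by apply: (@round_bound _ e S v); [move=> S' leS'; have := third S'|]; lia.
  (* Moore's bound and parity leave the orders 6, 8, 12 and 16. *)
  have [n8|n8] := leqP n 8.
    suff: game_dom_number e <= (n %/ 2 - 3).+2 by lia.
    by apply: first_move => S; have := third S; lia.
  have [n12|n12] := eqVneq n 12.
    suff: game_dom_number e <= 5 by lia.
    apply: first_move => S leS; have [U5|U6] := leqP #|undom e S| 5.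
      by have := third S; lia.
    by apply: (@cover 1 1); lia.
  suff: game_dom_number e <= 7 by lia.
  apply: first_move => S leS; have [U7|U8] := leqP #|undom e S| 7.
    by have := third S; lia.
  have [U9|U10] := leqP #|undom e S| 9; first by apply: (@cover 1 3); lia.
  by apply: (@cover 2 3); lia.
- have {}D2 : D = 2 by lia.
  rewrite D2 in nD2 nD.
  have [/outcome_4_2|n4] := eqVneq n 4; first exact.
  by apply: outcome_5_2 => //; lia.
Qed.
End MaximumDegree.

(** * Diameter two *)

Lemma has_diam2_nbhd_dom (T : finType) (e : rel T) : has_diam e 2 ->
  forall x y, x != y -> exists2 w, e x w & y \in cl_nbhd e w.
Proof.
case=> dist_le _ x y nxy; have [k [[p [pth lst szp]] _] k2] := dist_le x y.
case: p pth lst szp => [|w [|z [|? ?]]] /=; last by move=> _ _ kE; lia.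
- by move=> _ xy; rewrite xy eqxx in nxy.
- by rewrite andbT => xw <- _; exists w; rewrite // inE eqxx.
by case/and3P=> xw wz _ <- _; exists w; rewrite // inE wz orbT.
Qed.

Lemma has_diam2_degree (T : finType) (e : rel T) : symmetric e ->
  irreflexive e -> has_diam e 2 -> exists v, 1 < #|nbhd e v|.
Proof.
move=> esym eirr [_ [x [y [[p [pth lst szp]] min_p]]]].
case: p pth lst szp => [|w [|z [|]]] //= /and3P[xw wz _] zy _.
exists w; apply/card_gt1P; exists x, z; rewrite !inE esym xw wz; split=> //.
by apply/negP=> /eqP xz; have := min_p [::] isT; rewrite /= xz => /(_ zy).
Qed.

Theorem theorem3p1 (T : finType) (e : rel T)
    (esym : symmetric e) (eirr : irreflexive e) (ediam : has_diam e 2) :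
  game_dom_number e <= uphalf #|T| /\
  (game_dom_number e = uphalf #|T| <->
     (graph_iso e (@cycle_adj 4) \/
      graph_iso e (@cycle_adj 5) \/
      graph_iso e (@complete_bipartite 3 3) \/
      graph_iso e prism_adj \/
      graph_iso e (@edges_adj 6 edges_24) \/
      graph_iso e (@edges_adj 6 edges_124) \/
      graph_iso e (@edges_adj 6 edges_234) \/
      graph_iso e petersen_adj)).
Proof.
have nbhd_dom := has_diam2_nbhd_dom ediam.
have [v v_gt1] := has_diam2_degree esym eirr ediam.
(* [d] is a vertex of maximum degree. *)
have [|d deg_d] := eq_bigmax (fun x => #|nbhd e x|); first by apply/card_gt0P; exists v.
have max_deg x : #|nbhd e x| <= #|nbhd e d| by rewrite -deg_d; apply: leq_bigmax.
have d_gt1 := leq_trans v_gt1 (max_deg v).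
have n_gt2 : 2 < #|T|.
  by apply: leq_trans (max_card (cl_nbhd e d)); rewrite card_cl_nbhd.
have [lt_half|spo] := outcome_all esym eirr nbhd_dom max_deg erefl d_gt1 n_gt2.
  split; first exact: ltnW.
  by split=> [eq_half|/sporadic_game eq_half]; rewrite eq_half ltnn in lt_half.
have eq_half := sporadic_game spo.
by split; [rewrite eq_half|split=> _; [exact: spo|exact: eq_half]].
Qed.
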